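(* Let $G$ be a connected non-transmission-regular graph on $n$ vertices, and let $\tau(G) = 2D_{\max}(G) - \partial^Q(G)$. (1) If $n$ is odd, then \[ \tau(G)\geq \frac{n+2-\sqrt{n^2+4n-4}}{2}, \] with equality if and only if $G\cong K_{1,2,\ldots,2}$. (2) If $n$ is even, then \[ \tau(G)\geq \frac{n+4-\sqrt{n^2+8n}}{2}, \] with equality if and only if $G$ is isomorphic to some $(n-4)$-DVDR graph.
   Context: All graphs are finite, simple and undirected. For a connected graph $G$ with vertex set $\{v_1,\dots,v_n\}$, the distance matrix $D(G)$ is the $n\times n$ matrix whose $(i,j)$-entry is the distance $d_{ij}$ between $v_i$ and $v_j$. The transmission $D_i$ of $v_i$ is the $i$-th row sum of $D(G)$; $D_{\max}(G)$ and $D_{\min}(G)$ denote the maximum and minimum transmission over all vertices. $G$ is transmission-regular if $D_{\max}(G)=D_{\min}(G)$, and non-transmission-regular otherwise. The distance signless Laplacian matrix is $Q(G)=D(G)+\mathrm{diag}(D_1,\dots,D_n)$, and $\partial^Q(G)$ denotes its largest eigenvalue. A distinguished vertex deleted regular (DVDR) graph is a connected graph $G$ on $n$ vertices having a vertex $v$ of degree $n-1$ such that $G-v$ is regular; if $G-v$ is $r$-regular, $G$ is called an $r$-DVDR graph. For odd $n=2r-1$, $K_{1,2,\ldots,2}$ denotes the complete $r$-partite graph with one part of size $1$ and $r-1$ parts of size $2$. *)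

(* Defs.v *)
From HB Require Import structures.
From mathcomp Require Import all_boot all_order all_algebra.
From mathcomp Require Import fingroup perm reals.
Set Implicit Arguments. Unset Strict Implicit. Unset Printing Implicit Defensive.
Import Order.TTheory GRing.Theory Num.Theory.

Definition simple_graph (n : nat) (e : rel 'I_n) : Prop :=
  (forall x y, e x y = e y x) /\ (forall x, ~~ e x x).

Fixpoint walkn (n : nat) (e : rel 'I_n) (k : nat) (x y : 'I_n) : bool :=
  if k is k'.+1 then [exists z, e x z && walkn e k' z y] else x == y.

Definition connected (n : nat) (e : rel 'I_n) : Prop :=
  forall x y : 'I_n, exists k, walkn e k x y.

(* distance: the least k with a walk of length k from x to y
   (for a connected graph on n vertices, this k is < n). *)
Definition dist (n : nat) (e : rel 'I_n) (x y : 'I_n) : nat :=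
  find (fun k => walkn e k x y) (iota 0 n).

Definition trans (n : nat) (e : rel 'I_n) (i : 'I_n) : nat :=
  \sum_(j < n) dist e i j.

Definition Dmax (n : nat) (e : rel 'I_n) : nat := \max_(i < n) trans e i.

Definition transmission_regular (n : nat) (e : rel 'I_n) : Prop :=
  forall i j : 'I_n, trans e i = trans e j.

Local Open Scope ring_scope.

Definition dist_mx (R : realType) (n : nat) (e : rel 'I_n) : 'M[R]_n :=
  \matrix_(i, j) (dist e i j)%:R.

Definition distQ_mx (R : realType) (n : nat) (e : rel 'I_n) : 'M[R]_n :=
  dist_mx R e + diag_mx (\row_i (trans e i)%:R).

Definition largest_eigenvalue (R : realType) (n : nat) (A : 'M[R]_n) (lam : R)
  : Prop :=
  eigenvalue A lam /\ (forall mu, eigenvalue A mu -> mu <= lam).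

Definition graph_iso (n : nat) (e e' : rel 'I_n) : Prop :=
  exists f : {perm 'I_n}, forall x y, e x y = e' (f x) (f y).

(* K_{1,2,...,2} on 'I_n (n odd): part of vertex i is (i+1)./2, so vertex 0
   alone in part 0 and {2k-1, 2k} in part k. Adjacent iff different parts. *)
Definition K122 (n : nat) : rel 'I_n :=
  fun x y => ((x : nat).+1./2 != (y : nat).+1./2)%N.

Definition DVDR (n : nat) (r : nat) (e : rel 'I_n) : Prop :=
  simple_graph e /\ connected e /\
  exists v : 'I_n,
    (forall u, u != v -> e v u) /\
    (forall u, u != v -> #|[set w | (w != v) && e u w]| = r).

(* Main.v *)
Require Import Defs.
From HB Require Import structures.
From mathcomp Require Import all_boot all_order all_algebra.
From mathcomp Require Import fingroup perm reals.
From mathcomp Require Import ring lra zify.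
Import Order.TTheory GRing.Theory Num.Theory.
Local Open Scope ring_scope.

(* For a vector f, the quadratic form of 2 Dmax - Q is
     2 sum_j (Dmax - D_j) f_j^2 + sum_{i<j} d_ij (f_i - f_j)^2,
   and the second sum is at least sum_j (f_u - f_j)^2 for any fixed vertex u.
   If l is the small root of l^2 - (n + 2c) l + 2c = 0, then
     2 c f_u^2 + sum_j (f_u - f_j)^2 - l sum_j f_j^2
       = sum_{j <> u} (f_u - (1 - l) f_j)^2 / (1 - l) >= 0,
   so a vertex u with Dmax - D_u >= c forces tau >= l.  In the case of equality
   the eigenvector is constant off u, and the eigenvalue equation then makes u
   adjacent to all other vertices, which all have transmission Dmax = n - 1 + c.
   Non-regularity gives c = 1.  As the transmissions sum to an even number, for
   even n the deficiencies cannot sum to 1: either c = 2 is possible, or two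
   vertices are deficient and the bound for c = 2 is strict. *)

(** * Walks and distances *)

Section Distance.
Variables (n : nat) (e : rel 'I_n).
Hypothesis se : simple_graph e.

Lemma walkn_rcons k x y :
  walkn e k.+1 x y = [exists z, walkn e k x z && e z y].
Proof.
elim: k x => [|k IH] x.
  apply/existsP/existsP => -[z /andP[]] /=.
    by move=> xz /eqP <-; exists x; rewrite eqxx.
  by move=> /eqP <- xy; exists y; rewrite eqxx xy.
rewrite -[LHS]/([exists z, e x z && walkn e k.+1 z y]).
under eq_existsb do rewrite IH.
apply/existsP/existsP => -[z /andP[]].
  move=> xz /existsP[w /andP[zw wy]]; exists w; rewrite wy andbT.
  by apply/existsP; exists z; rewrite xz.
move=> /existsP[w /andP[xw wz]] zy; exists w; rewrite xw.
by apply/existsP; exists z; apply/andP.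
Qed.

Lemma walkn_sym k x y : walkn e k x y = walkn e k y x.
Proof.
elim: k x y => [|k IH] x y; first exact: eq_sym.
rewrite walkn_rcons; apply: eq_existsb => z.
by rewrite IH se.1 andbC.
Qed.

Lemma dist_sym x y : dist e x y = dist e y x.
Proof. by apply: eq_find => k; apply: walkn_sym. Qed.

Lemma distxx x : dist e x x = 0%N.
Proof. by case: n e x => [? [] //|m e0 x]; rewrite /dist /= eqxx. Qed.

Lemma dist_gt0 x y : x != y -> (0 < dist e x y)%N.
Proof. by case: n e x y => [? []|m e' x y] xy //; rewrite /dist /= (negPf xy). Qed.

Lemma walkn1 x y : walkn e 1 x y = e x y.
Proof.
apply/existsP/idP => [[z /andP[xz /eqP <-]] //|xy].
by exists y; rewrite xy /=.
Qed.

Lemma dist_eq1 x y : x != y -> (dist e x y == 1%N) = e x y.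
Proof.
move: (walkn1 x y) => w1 xy.
(* [dist] equals [n] when its search fails; [1 < n] keeps this value apart from 1 and makes 1 a
   searched length. *)
have n1 : (1 < n)%N.
  move: (ltn_ord x) (ltn_ord y) xy; rewrite -val_eqE /=; lia.
rewrite /dist; case: n e x y w1 xy n1 => [|[|m]] // e' x y w1 xy _.
rewrite /= (negPf xy); move: w1 => /= ->.
by case: (e' x y).
Qed.

Lemma dist_eq2 x y z : x != y -> ~~ e x y -> e x z -> e z y -> dist e x y = 2.
Proof.
move=> xy nxy xz zy.
have n1 : (2 < n)%N.
  have xz' : x != z by apply: contraNneq nxy => ->.
  have zy' : z != y by apply: contraNneq nxy => <-.
  by move: (ltn_ord x) (ltn_ord y) (ltn_ord z) xy xz' zy'; rewrite -!val_eqE /=; lia.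
have w1 := walkn1 x y.
have w2 : walkn e 2 x y.
  by rewrite walkn_rcons; apply/existsP; exists z; rewrite walkn1 xz.
rewrite /dist; case: n e x y {z xz zy} w1 w2 nxy xy n1
  => [|[|[|m]]] // e' x y w1 w2 nxy xy _.
rewrite /= (negPf xy); move: w1 w2 => /= -> ->.
by rewrite (negPf nxy).
Qed.

(** Handshake argument: distances are symmetric and vanish on the diagonal, so each unordered pair
    is counted twice. *)
Lemma odd_sum_trans : ~~ odd (\sum_(i < n) trans e i).
Proof.
have -> : (\sum_(i < n) trans e i = (\sum_(i < n) \sum_(j < n | j < i) dist e i j).*2)%N.
  transitivity (\sum_(i < n) ((\sum_(j < n | j < i) dist e i j) +
                  \sum_(j < n | i < j) dist e i j))%N.
    apply: eq_bigr => i _; rewrite /trans (bigID (fun j : 'I_n => j < i)%N) /=.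
    congr addn; rewrite (bigD1 i) ?ltnn //= distxx add0n.
    by apply: eq_bigl => j; rewrite -leqNgt ltn_neqAle -val_eqE /= eq_sym andbC.
  rewrite big_split /= -addnn; congr addn.
  rewrite (exchange_big_dep predT) //=.
  by do 2![apply: eq_bigr => ? _]; apply: dist_sym.
by rewrite odd_double.
Qed.

End Distance.

(** * The quadratic equation behind the bounds, and the star inequality *)

Section SmallRoot.
Variable R : realType.

(** The polynomial x^2 - (m + 2 c) x + 2 c is positive at 0 and equals 1 - m < 0 at 1, so its small
    root lies strictly between them. *)
Lemma small_root (m c : R) : 1 < m -> 0 < c ->
  let l := (m + 2 * c - Num.sqrt ((m + 2 * c) ^+ 2 - 8 * c)) / 2 in
  [/\ 0 < l, l < 1 & l ^+ 2 + 2 * c = (m + 2 * c) * l].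
Proof.
move=> m1 c0 l; rewrite /l.
have d0 : 0 <= (m + 2 * c) ^+ 2 - 8 * c.
  have -> : (m + 2 * c) ^+ 2 - 8 * c = (m + 2 * c - 2) ^+ 2 + 4 * (m - 1) by ring.
  by rewrite addr_ge0 ?sqr_ge0 //; lra.
have := sqr_sqrtr d0; have := sqrtr_ge0 ((m + 2 * c) ^+ 2 - 8 * c).
set s := Num.sqrt _ => s0 sE.
have s_lt : s < m + 2 * c by rewrite ltNge; apply/negP => s_ge; nra.
have s_gt : m + 2 * c - 2 < s by rewrite ltNge; apply/negP => s_le; nra.
split; [lra|lra|].
have -> : ((m + 2 * c - s) / 2) ^+ 2 =
  ((m + 2 * c) ^+ 2 - 2 * (m + 2 * c) * s + s ^+ 2) / 4 by field.
by rewrite sE; field.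
Qed.

Variables (n : nat) (f : 'I_n -> R) (u : 'I_n) (c l : R).
Hypotheses (l1 : l < 1) (lE : l ^+ 2 + 2 * c = (n%:R + 2 * c) * l).

Lemma star_identity :
  2 * c * f u ^+ 2 + \sum_j (f u - f j) ^+ 2 - l * \sum_j f j ^+ 2 =
  (\sum_(j | j != u) (f u - (1 - l) * f j) ^+ 2) / (1 - l).
Proof.
have l0 : 1 - l != 0 by rewrite subr_eq0 gt_eqF.
rewrite (bigD1 u) //= (bigD1 u (F := fun j => f j ^+ 2)) //=.
(* The equation for [l] spreads 2 c over the vertices: the share [l] of [u] cancels its term in the
   norm, and each share l / (1 - l) completes one square. *)
have -> : 2 * c = l + \sum_(j < n | j != u) (l / (1 - l)).
  rewrite sumr_const (@eq_card _ _ (predC1 u)) // cardC1 card_ord.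
  have nE : n%:R = n.-1%:R + 1 :> R by rewrite natr1 (ltn_predK (ltn_ord u)).
  have := lE; rewrite nE => E; rewrite -[X in l + X]mulr_natr; apply: (mulfI l0).
  have -> : (1 - l) * (l + l / (1 - l) * n.-1%:R) = (1 - l) * l + l * n.-1%:R by field.
  lra.
rewrite subrr expr0n add0r mulrDl mulrDr mulr_suml mulr_suml mulr_sumr.
transitivity (\sum_(j < n | j != u)
   (l / (1 - l) * f u ^+ 2 + (f u - f j) ^+ 2 - l * f j ^+ 2)).
  by rewrite sumrB big_split /=; ring.
by apply: eq_bigr => j _; field.
Qed.

Lemma star_le :
  l * \sum_j f j ^+ 2 <= 2 * c * f u ^+ 2 + \sum_j (f u - f j) ^+ 2.
Proof.
rewrite -subr_ge0 star_identity; apply: divr_ge0; last by rewrite subr_ge0 ltW.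
by apply: sumr_ge0 => j _; apply: sqr_ge0.
Qed.

Lemma star_eq :
  2 * c * f u ^+ 2 + \sum_j (f u - f j) ^+ 2 <= l * \sum_j f j ^+ 2 ->
  forall j, j != u -> f u = (1 - l) * f j.
Proof.
rewrite -subr_le0 star_identity pmulr_lle0 ?invr_gt0 ?subr_gt0 //.
move=> le0 j ju.
have s0 : \sum_(j | j != u) (f u - (1 - l) * f j) ^+ 2 == 0.
  by rewrite eq_le le0 sumr_ge0 // => i _; apply: sqr_ge0.
move: s0; rewrite psumr_eq0 => [/allP/(_ j)|i _]; last exact: sqr_ge0.
by rewrite mem_index_enum ju sqrf_eq0 subr_eq0 => /(_ isT)/eqP.
Qed.

End SmallRoot.

(** * The quadratic form of 2 Dmax - Q *)

Section Spectral.
Variables (R : realType) (n : nat) (e : rel 'I_n).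
Hypothesis se : simple_graph e.
Implicit Types (v : 'rV[R]_n) (lam c l : R).

Let d i j : R := (dist e i j)%:R.
Let deficiency i : R := (Dmax e)%:R - (trans e i)%:R.
(** The Laplacian form weighted by distances, in the unsymmetric shape that arises when the
    eigenvalue equation at [j] is multiplied by [f j] and summed. *)
Let energy (f : 'I_n -> R) := \sum_j \sum_i d j i * (f j - f i) * f j.

Lemma dC i j : d i j = d j i.
Proof. by rewrite /d dist_sym. Qed.

Lemma d_ge1 i j : i != j -> 1 <= d i j.
Proof. by move=> ij; rewrite ler1n dist_gt0. Qed.

Lemma trans_le_Dmax i : (trans e i <= Dmax e)%N.
Proof. exact: leq_bigmax. Qed.

Lemma deficiency_ge0 i : 0 <= deficiency i.
Proof. by rewrite subr_ge0 ler_nat trans_le_Dmax. Qed.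

(** The row sums of [d] are the transmissions, so 2 Dmax - Q is the diagonal of doubled deficiencies
    plus the Laplacian with weights [d]. *)
Lemma distQ_eigenP v lam :
  v *m distQ_mx R e = lam *: v <->
  forall j, (2 * (Dmax e)%:R - lam) * v 0 j =
            2 * deficiency j * v 0 j + \sum_i d j i * (v 0 j - v 0 i).
Proof.
have E j : (v *m distQ_mx R e) 0 j =
    (trans e j)%:R * v 0 j + \sum_i d j i * v 0 i.
  rewrite mulmxDr mul_mx_diag !mxE addrC mulrC; congr (_ + _).
  by apply: eq_bigr => i _; rewrite mxE -/(d i j) dC mulrC.
have S j : \sum_i d j i * (v 0 j - v 0 i) =
    (trans e j)%:R * v 0 j - \sum_i d j i * v 0 i.
  rewrite /trans natr_sum mulr_suml -sumrB.
  by apply: eq_bigr => i _; rewrite mulrBr.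
split=> [/rowP vQ j|vQ].
  by have := vQ j; rewrite E S /deficiency mxE; lra.
by apply/rowP => j; have := vQ j; rewrite E S /deficiency mxE; lra.
Qed.

Lemma energyE f : energy f = (\sum_j \sum_i d j i * (f j - f i) ^+ 2) / 2.
Proof.
have E : energy f = \sum_j \sum_i d j i * (f i - f j) * f i.
  by rewrite /energy exchange_big; do 2![apply: eq_bigr => ? _]; rewrite dC.
have -> : energy f = (energy f + energy f) / 2 by lra.
rewrite {2}E -big_split /=; congr (_ / _); apply: eq_bigr => j _.
by rewrite -big_split /=; apply: eq_bigr => i _; ring.
Qed.

(** The star at [u] occurs twice among the ordered pairs, as a row and as a column, which pays for
    the factor 1/2 in [energyE]. Its weights off [u] are at least 1, and all other terms are
    nonnegative. *)
Lemma star_le_energy f u : \sum_j (f u - f j) ^+ 2 <= energy f.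
Proof.
pose g i j := d i j * (f i - f j) ^+ 2.
have g0 i j : 0 <= g i j by rewrite mulr_ge0 ?sqr_ge0 ?ler0n.
have gC i j : g i j = g j i by rewrite /g dC -sqrrN opprB.
have guu : g u u = 0 by rewrite /g subrr expr0n mulr0.
have gu : \sum_j (f u - f j) ^+ 2 <= \sum_j g u j.
  apply: ler_sum => j _; have [->|uj] := eqVneq u j.
    by rewrite subrr expr0n; apply: g0.
  by rewrite ler_peMl ?sqr_ge0 ?d_ge1.
apply: (le_trans gu); rewrite energyE ler_pdivlMr // mulr_natr mulr2n.
rewrite [leRHS](bigD1 u) //= lerD2l [leLHS](bigD1 u) //= guu add0r.
apply: ler_sum => i _; rewrite gC (bigD1 u) //= lerDl.
by apply: sumr_ge0 => j _; apply: g0.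
Qed.

Lemma rayleigh v lam : v *m distQ_mx R e = lam *: v ->
  (2 * (Dmax e)%:R - lam) * \sum_j v 0 j ^+ 2 =
  \sum_j 2 * deficiency j * v 0 j ^+ 2 + energy (v 0).
Proof.
move=> /distQ_eigenP vQ; rewrite mulr_sumr -big_split /=.
apply: eq_bigr => j _; rewrite expr2 [LHS]mulrA vQ mulrDl -[X in X + _]mulrA.
by rewrite mulr_suml.
Qed.

Lemma sqr_sum_gt0 v : v != 0 -> 0 < \sum_j v 0 j ^+ 2.
Proof.
move=> v0; rewrite lt_neqAle sumr_ge0 ?andbT => [|j _]; last exact: sqr_ge0.
apply: contraNneq v0 => /esym/eqP; rewrite psumr_eq0 => [|j _]; last exact: sqr_ge0.
move=> /allP s0; apply/eqP/rowP => j; rewrite mxE.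
by have := s0 j; rewrite mem_index_enum sqrf_eq0 => /(_ isT)/eqP.
Qed.

(** Of the form in [rayleigh], only the deficiency of [u] and the star at [u] are kept before
    [star_le] applies; if tau equals [l], nothing was lost and [star_eq] applies. *)
Lemma deficient_vertex_bound v lam u c l :
  v *m distQ_mx R e = lam *: v -> v != 0 ->
  l < 1 -> l ^+ 2 + 2 * c = (n%:R + 2 * c) * l -> c <= deficiency u ->
  l <= 2 * (Dmax e)%:R - lam /\
  (2 * (Dmax e)%:R - lam = l -> forall j, j != u -> v 0 u = (1 - l) * v 0 j).
Proof.
move=> vQ v0 l1 lE cu; have q0 := sqr_sum_gt0 v v0.
have := rayleigh v lam vQ; have star := star_le_energy (v 0) u.
have le := star_le _ _ (v 0) u c l l1 lE.
have : 2 * c * v 0 u ^+ 2 <= \sum_j 2 * deficiency j * v 0 j ^+ 2.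
  rewrite (bigD1 u) //=; apply: ler_wpDr.
    by apply: sumr_ge0 => j _; rewrite mulr_ge0 ?sqr_ge0 // mulr_ge0 // deficiency_ge0.
  by rewrite ler_wpM2r ?sqr_ge0 // ler_wpM2l.
move=> cle ray; split; first by rewrite -(ler_pM2r q0) ray; lra.
by move=> tE; apply: (star_eq _ _ (v 0) u c l l1 lE); rewrite -tE ray; lra.
Qed.

(* Each deficient vertex contributes only half of the term [4 f u ^ 2] of the
   star inequality for [c = 2], so the two star inequalities are averaged; they
   cannot both be equalities. *)
Lemma two_deficient_vertices_bound v lam u w l :
  v *m distQ_mx R e = lam *: v -> v != 0 ->
  0 < l -> l < 1 -> l ^+ 2 + 2 * 2 = (n%:R + 2 * 2) * l ->
  u != w -> 1 <= deficiency u -> 1 <= deficiency w ->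
  l < 2 * (Dmax e)%:R - lam.
Proof.
move=> vQ v0 l0 l1 lE uw du dw; have q0 := sqr_sum_gt0 v v0.
have := rayleigh v lam vQ.
have starU := star_le_energy (v 0) u; have starW := star_le_energy (v 0) w.
have leU := star_le _ _ (v 0) u 2 l l1 lE.
have leW := star_le _ _ (v 0) w 2 l l1 lE.
have : 2 * v 0 u ^+ 2 + 2 * v 0 w ^+ 2 <= \sum_j 2 * deficiency j * v 0 j ^+ 2.
  rewrite (bigD1 u) //= (bigD1 w) 1?eq_sym //= addrA; apply: ler_wpDr.
    by apply: sumr_ge0 => j _; rewrite mulr_ge0 ?sqr_ge0 // mulr_ge0 // deficiency_ge0.
  by apply: lerD; rewrite ler_wpM2r ?sqr_ge0 // -[leLHS]mulr1 ler_wpM2l.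
move=> dle ray; rewrite -(ltr_pM2r q0) ray ltNge; apply/negP => ge.
have eqU := star_eq _ _ (v 0) u 2 l l1 lE; have eqW := star_eq _ _ (v 0) w 2 l l1 lE.
have {}eqU : forall j, j != u -> v 0 u = (1 - l) * v 0 j by apply: eqU; lra.
have {}eqW : forall j, j != w -> v 0 w = (1 - l) * v 0 j by apply: eqW; lra.
(* Each equality condition is read at the centre of the other star: v_u = (1 - l)^2 v_u, with 0 < 1
   - l < 1. *)
have vu0 : v 0 u = 0.
  have := eqU w; rewrite eq_sym => /(_ uw) U; have W := eqW u uw.
  have : (1 - (1 - l) ^+ 2) * v 0 u = 0.
    by rewrite mulrBl mul1r expr2 -mulrA -W -U subrr.
  move=> /eqP; rewrite mulf_eq0 => /orP[/eqP|/eqP //]; nra.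
case/negP: v0; apply/eqP/rowP => j; rewrite mxE.
have [-> //|ju] := eqVneq j u.
have := eqU j ju; rewrite vu0 => /esym/eqP; rewrite mulf_eq0 => /orP[/eqP|/eqP //].
lra.
Qed.

(** Off [u] the vector is a constant [b], so the equation at [j != u] reduces to l = 2 deficiency j
    + d u j l. As deficiencies are nonnegative and distances at least 1, these must be 0 and 1. *)
Lemma extremal_shape v lam u c l :
  v *m distQ_mx R e = lam *: v -> v != 0 ->
  0 < l -> l < 1 -> l ^+ 2 + 2 * c = (n%:R + 2 * c) * l ->
  2 * (Dmax e)%:R - lam = l ->
  (forall j, j != u -> v 0 u = (1 - l) * v 0 j) ->
  [/\ forall j, j != u -> dist e u j = 1%N,
      forall j, j != u -> trans e j = Dmax e & deficiency u = c].
Proof.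
move=> /distQ_eigenP vQ v0 l0 l1 lE tE vu.
have l10 : 1 - l != 0 by rewrite subr_eq0 gt_eqF.
pose b := v 0 u / (1 - l).
have vj j : j != u -> v 0 j = b.
  by move=> /vu; rewrite /b => ->; field.
have vuE : v 0 u = (1 - l) * b by rewrite /b; field.
have b0 : b != 0.
  apply: contraNneq v0 => b0; apply/eqP/rowP => j; rewrite mxE.
  by have [->|/vj ->] := eqVneq j u; rewrite ?vuE b0 ?mulr0.
have other j : j != u -> l = 2 * deficiency j + d u j * l.
  move=> ju; apply: (mulIf b0); have := vQ j.
  rewrite tE (bigD1 u) //= big1 => [|i iu]; last by rewrite !vj // subrr mulr0.
  by rewrite vj // vuE (dC j u) => ->; ring.
have tight j : j != u -> d u j = 1 /\ deficiency j = 0.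
  move=> ju; have := other j ju; have := deficiency_ge0 j.
  have : 1 <= d u j by rewrite d_ge1 // eq_sym.
  by move=> d1 D0 E; split; nra.
split.
- by move=> j /tight[/eqP]; rewrite /d pnatr_eq1 => /eqP.
- by move=> j /tight[_ /eqP]; rewrite subr_eq0 eqr_nat eq_sym => /eqP.
(* The equation at [u] becomes 2 deficiency u (1 - l) = l (n - l), and the right side is 2 c (1 - l)
   by the quadratic equation. *)
have := vQ u; rewrite tE (bigD1 u) //= subrr mulr0 add0r vuE.
rewrite (eq_bigr (fun _ => - (l * b))) => [|j ju]; last first.
  by rewrite (tight j ju).1 vj //; ring.
rewrite sumr_const (@eq_card _ _ (predC1 u)) // cardC1 card_ord -[X in _ = _ + X]mulr_natr.
have nE : n%:R = n.-1%:R + 1 :> R by rewrite natr1 (ltn_predK (ltn_ord u)).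
move=> E.
have {}E : l * (1 - l) = 2 * deficiency u * (1 - l) - l * n.-1%:R.
  by apply: (mulIf b0); lra.
by apply: (mulfI l10); move: lE; rewrite nE; lra.
Qed.

End Spectral.

(** * Cones over regular graphs *)

(** The condition of [DVDR] with its apex exposed, so that the deficient vertex can be identified as
    the apex. *)
Definition cone_regular {n : nat} (v : 'I_n) (r : nat) (e : rel 'I_n) : Prop :=
  (forall u, u != v -> e v u) /\
  (forall u, u != v -> #|[set w | (w != v) && e u w]| = r).

Lemma cone_regular_iso (n : nat) (e e' : rel 'I_n) (f : {perm 'I_n}) v r :
  (forall x y, e x y = e' (f x) (f y)) -> cone_regular (f v) r e' -> cone_regular v r e.
Proof.
move=> fE [adj reg]; split=> u uv; first by rewrite fE adj // (inj_eq perm_inj).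
rewrite -(reg (f u)) ?(inj_eq perm_inj) // -(card_imset _ (@perm_inj _ f)).
apply: eq_card => y; rewrite -(permKV f y) mem_imset ?inE; last exact: perm_inj.
by rewrite fE (inj_eq perm_inj).
Qed.

Section Cone.
Variables (n : nat) (e : rel 'I_n) (u : 'I_n).
Hypotheses (se : simple_graph e) (adj : forall x, x != u -> e u x).

Lemma trans_dominating : (trans e u).+1 = n.
Proof.
rewrite /trans (bigD1 u) //= distxx add0n (eq_bigr (fun _ => 1%N)) => [|j ju].
  rewrite sum_nat_const muln1 (@eq_card _ _ (predC1 u)) // cardC1 card_ord.
  exact: ltn_predK (ltn_ord u).
by apply/eqP; rewrite dist_eq1 ?adj // eq_sym.
Qed.

(* The diameter is at most 2, so each vertex is at distance 2 from its
   non-neighbours. *)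
Lemma trans_dominated x : x != u ->
  (trans e x + #|[set w | (w != u) && e x w]| + 3 = n.*2)%N.
Proof.
move=> xu; rewrite -sum1_card big_mkcond /=.
(* The 3 is split so that every vertex contributes 2: [x] receives 2, the apex receives 1 for its
   distance 1, a neighbour counts 1 + 1 and a non-neighbour 2 + 0. *)
have -> : (3 = \sum_(j < n) ((j == x) * 2 + (j == u)))%N.
  rewrite big_split /= -big_distrl /= -!big_mkcond /=.
  by rewrite !big_pred1_eq.
rewrite /trans -!big_split /=.
have -> : (n.*2 = \sum_(j < n) 2)%N by rewrite sum_nat_const card_ord muln2.
apply: eq_bigr => j _; rewrite !inE; have [->|jx] := eqVneq j x.
  by rewrite distxx (negPf xu) (negPf (se.2 x)).
have [->|ju] := eqVneq j u.
  by move: (dist_eq1 _ e x u xu); rewrite (se.1 x u) adj // => /eqP ->.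
have [xj|xj] := boolP (e x j).
  by move: (dist_eq1 _ e x j); rewrite xj eq_sym jx => /(_ isT)/eqP ->.
by rewrite (dist_eq2 _ e x j u) ?adj // 1?eq_sym // se.1 adj.
Qed.

End Cone.

(** * Equality in the bounds and cones over regular graphs *)

Section Extremal.
Variables (R : realType) (n : nat) (e : rel 'I_n).
Hypothesis se : simple_graph e.

Lemma cone_regular_trans u r x : cone_regular u r e -> x != u ->
  (trans e x + r + 3 = n.*2)%N.
Proof. by move=> [adj reg] xu; rewrite -(reg x xu) (trans_dominated _ _ u). Qed.

(** For the converse direction: the largest eigenvalue is at least this one, hence tau is at most
    [l]. *)
Lemma cone_regular_eigenvalue u r k (l : R) :
  cone_regular u r e -> (r + k + 2 = n)%N ->
  l ^+ 2 + 2 * k%:R = (n%:R + 2 * k%:R) * l ->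
  eigenvalue (distQ_mx R e) (2 * (Dmax e)%:R - l).
Proof.
move=> cr rk lE; have tu := trans_dominating _ e u cr.1.
have tx x : x != u -> trans e x = (n.-1 + k)%N.
  by move=> /(cone_regular_trans _ _ _ cr); lia.
have n1 : (1 < n)%N by lia.
have [x xu] : exists x, x != u.
  have : (0 < #|predC1 u|)%N by rewrite cardC1 card_ord; lia.
  by move=> /card_gt0P[x]; exists x.
have DE : Dmax e = (n.-1 + k)%N.
  apply/eqP; rewrite eqn_leq -{2}(tx x xu) leq_bigmax andbT.
  apply/bigmax_leqP => y _; have [->|/tx -> //] := eqVneq y u; lia.
have d1 y : y != u -> dist e u y = 1%N.
  by move=> yu; apply/eqP; rewrite dist_eq1 ?cr.1 // eq_sym.
(* The equality case of the star inequality, scaled to 1 off the apex. *)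
pose v := \row_j (if j == u then 1 - l else 1) : 'rV[R]_n.
apply/eigenvalueP; exists v; last first.
  by apply/eqP => /rowP/(_ x)/eqP; rewrite !mxE (negPf xu) oner_eq0.
apply/(distQ_eigenP _ _ _ se) => j; rewrite (bigD1 u) //= !mxE eqxx.
have [->|ju] := eqVneq j u.
  rewrite (eq_bigr (fun _ => - l)) => [|y yu]; last first.
    by rewrite d1 // !mxE (negPf yu); ring.
  rewrite sumr_const (@eq_card _ _ (predC1 u)) // cardC1 card_ord -[X in _ = _ + (_ + X)]mulr_natr.
  have nE : n%:R = n.-1%:R + 1 :> R by rewrite natr1 (ltn_predK (ltn_ord u)).
  have -> : (trans e u = n.-1)%N by lia.
  rewrite DE natrD; move: lE; rewrite nE; lra.
rewrite big1 => [|y yu]; last by rewrite !mxE (negPf yu) subrr mulr0.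
rewrite tx // DE dist_sym // d1 //; ring.
Qed.

Lemma deficient_vertex_extremal u k lam (v : 'rV[R]_n) :
  let l := (n%:R + 2 * k%:R - Num.sqrt ((n%:R + 2 * k%:R) ^+ 2 - 8 * k%:R)) / 2 in
  (1 < n)%N -> (0 < k)%N -> (trans e u + k <= Dmax e)%N ->
  v *m distQ_mx R e = lam *: v -> v != 0 ->
  l <= 2 * (Dmax e)%:R - lam /\
  (2 * (Dmax e)%:R - lam = l -> exists2 r, (r + k + 2 = n)%N & cone_regular u r e).
Proof.
move=> l n1 k0 tu vQ v0.
have [l0 l1 lE] : [/\ 0 < l, l < 1 & l ^+ 2 + 2 * k%:R = (n%:R + 2 * k%:R) * l].
  by apply: small_root; rewrite ?ltr1n ?ltr0n.
have du : k%:R <= (Dmax e)%:R - (trans e u)%:R :> R.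
  by rewrite lerBrDl -natrD ler_nat.
have [bound shape] := deficient_vertex_bound _ _ _ se v lam u _ l vQ v0 l1 lE du.
split=> // tE.
have [d1 tx du'] := extremal_shape _ _ _ se v lam u _ l vQ v0 l0 l1 lE tE (shape tE).
have adj x : x != u -> e u x.
  by move=> xu; rewrite -dist_eq1 1?eq_sym // d1.
have tuE := trans_dominating _ e u adj.
have DE : (Dmax e = trans e u + k)%N.
  by apply/eqP; rewrite -(eqr_nat R) natrD -du' addrC subrK.
have deg x (xu : x != u) := trans_dominated _ _ u se adj x xu.
(* Every [x != u] has transmission Dmax = n - 1 + k, so [deg] fixes its degree off the apex. *)
have rE x : x != u -> (#|[set w | (w != u) && e x w]| + k + 2 = n)%N.
  by move=> xu; have := deg x xu; rewrite tx // DE; lia.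
have [x xu] : exists x, x != u.
  have : (0 < #|predC1 u|)%N by rewrite cardC1 card_ord; lia.
  by move=> /card_gt0P[x]; exists x.
exists (n - k - 2)%N; first by have := rE x xu; lia.
by split=> // y yu; have := rE y yu; lia.
Qed.

End Extremal.

(** * Recognition of K_{1,2,...,2} *)

(** Partners are listed consecutively, at positions 2 i and 2 i + 1, so halving an index gives the
    number of its pair. The induction removes one pair {a, m a} at a time. *)
Lemma matching_enum (T : finType) (m : T -> T) (A : {set T}) :
  (forall x, x \in A -> [/\ m x \in A, m x != x & m (m x) = x]) ->
  exists s, [/\ uniq s, s =i A & {in A &, forall x y,
    ((index x s)./2 == (index y s)./2) = (x == y) || (y == m x)}].
Proof.
have [k] := ubnP #|A|; elim: k A => // k IH A Ak mA.
have [A0|[a aA]] := set_0Vmem A.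
  by exists [::]; split=> // [x|x y]; rewrite A0 inE.
have [maA maa mma] := mA a aA.
pose B := A :\ a :\ m a.
have inB x : (x \in B) = [&& x != m a, x != a & x \in A] by rewrite !inE.
have Bk : (#|B| < k)%N.
  by move: Ak; rewrite (cardsD1 a A) aA (cardsD1 (m a) (A :\ a)) !inE maa maA /= -/B; lia.
have mB x : x \in B -> [/\ m x \in B, m x != x & m (m x) = x].
  rewrite inB => /and3P[xma xa xA]; have [mxA mxx mmx] := mA x xA; split=> //.
  rewrite inB mxA andbT; apply/andP; split.
    by apply: contraNneq xa => E; rewrite -mmx E mma.
  by apply: contraNneq xma => E; rewrite -mmx E.
have [s [us sB sE]] := IH B Bk mB.
exists [:: a, m a & s]; split.
- by rewrite /= inE eq_sym negb_or maa !sB !inB !eqxx us andbF.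
- by move=> x; rewrite !inE sB inB; have [->|] := eqVneq x a; rewrite ?aA //=;
    have [->|] := eqVneq x (m a); rewrite ?maA.
have idx x : (index x [:: a, m a & s])./2 =
    if (x == a) || (x == m a) then 0%N else (index x s)./2.+1.
  rewrite /= eq_sym; have [//|_] := eqVneq x a.
  by rewrite eq_sym; have [|] := eqVneq x (m a).
move=> x y xA yA; rewrite !idx.
have [x_a|x_a] := boolP ((x == a) || (x == m a)).
  have -> : (x == y) || (y == m x) = (y == a) || (y == m a).
    by case/orP: x_a => /eqP ->; rewrite ?mma // (eq_sym _ y) // orbC.
  by case: ifP.
have xB : x \in B by move: x_a; rewrite inB xA andbT negb_or andbC.
have [y_a|y_a] := boolP ((y == a) || (y == m a)); last first.
  by rewrite eqSS sE // inB yA andbT -negb_or orbC.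
apply/esym/negbTE; apply: contra x_a => /orP[/eqP -> //|/eqP yE].
have [_ _ <-] := mA x xA; rewrite -yE.
by case/orP: y_a => /eqP ->; rewrite ?mma eqxx ?orbT.
Qed.

(** G - u has n - 1 vertices and degree n - 3, so each of its vertices has exactly one non-neighbour
    other than itself; by symmetry this defines an involution without fixed points. *)
Lemma cone_regular_K122 (n : nat) (e : rel 'I_n) u r :
  simple_graph e -> (r + 3 = n)%N -> cone_regular u r e -> graph_iso e (@K122 n).
Proof.
move=> se rn [adj reg].
pose N x := ([set~ u] :\ x) :\: [set w | (w != u) && e x w].
have inN x w : (w \in N x) = [&& ~~ e x w, w != x & w != u].
  by rewrite !inE; case: (w != u); rewrite /= ?andbT ?andbF.
have cN x : x != u -> #|N x| = 1%N.
  move=> xu; rewrite cardsD.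
  have -> : ([set~ u] :\ x) :&: [set w | (w != u) && e x w] = [set w | (w != u) && e x w].
    apply/setP => w; rewrite !inE; case: (w != u); rewrite /= ?andbF ?andbT //.
    by have [->|] := eqVneq w x; rewrite // (negPf (se.2 x)).
  rewrite reg //; have := cardsD1 x [set~ u]; rewrite !inE xu cardsC1 card_ord /=; lia.
(* The default is reached only at [u], which is adjacent to all other vertices. *)
pose m x := odflt x [pick w in N x].
have mP x : x != u -> forall w, (w \in N x) = (w == m x).
  move=> xu w; have /eqP/cards1P[z Nz] := cN x xu.
  rewrite /m; case: pickP => [y|/(_ z)]; last by rewrite Nz inE eqxx.
  by rewrite Nz !inE => /eqP ->.
have mN x : x != u -> [/\ m x != u, m x != x & ~~ e x (m x)].
  by move=> xu; have := mP x xu (m x); rewrite eqxx inN => /and3P[].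
have [x|s [us sA sE]] := matching_enum _ m [set~ u].
  rewrite !inE => xu; have [mu mx nx] := mN x xu; split=> //.
  by apply/esym/eqP; rewrite -mP // inN se.1 nx eq_sym mx.
have us' : uniq (u :: s) by rewrite /= sA !inE eqxx.
have su x : x \in u :: s by rewrite inE sA !inE orbN.
have sz : size (u :: s) = n.
  by rewrite -(card_uniqP us') -[RHS]card_ord; apply: eq_card => x; rewrite su.
have idx_lt x : (index x (u :: s) < n)%N by rewrite -[X in (_ < X)%N]sz index_mem.
pose f x := Ordinal (idx_lt x).
have f_inj : injective f.
  by move=> x y /(congr1 val) /= E; apply: (index_inj (s := u :: s) u) => //; rewrite E.
exists (perm f_inj) => x y; rewrite !permE /K122.
have fu : f u = 0%N :> nat by rewrite /= eqxx.
(* With [u] in front, the pair at 2 i, 2 i + 1 in [s] moves to 2 i + 1, 2 i + 2, which is part i + 1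
   of [K122]. *)
have fx z : z != u -> (f z).+1./2 = (index z s)./2.+1.
  by move=> zu; rewrite /= eq_sym (negPf zu).
have [->|xu] := eqVneq x u.
  have [->|yu] := eqVneq y u; first by rewrite eqxx (negPf (se.2 u)).
  by rewrite fu fx // adj.
have [->|yu] := eqVneq y u; first by rewrite fu fx // se.1 adj.
rewrite !fx // eqSS sE ?inE // -mP // inN yu andbT.
have [->|yx] := eqVneq y x; first by rewrite (negPf (se.2 x)).
by rewrite andbT negbK.
Qed.

(** The apex is vertex 0. The conclusion [2 < n] makes the truncated [n - 3] exact. *)
Lemma K122_cone_regular (n : nat) : odd n -> (1 < n)%N ->
  exists2 v, cone_regular v (n - 3) (@K122 n) & (2 < n)%N.
Proof.
move=> on n1; have n2 : (2 < n)%N by lia.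
have n0 : (0 < n)%N by lia.
exists (Ordinal n0) => //; split=> u.
  by rewrite -val_eqE /K122 /=; have := ltn_ord u; lia.
rewrite -val_eqE /= => u0.
(* The other vertex in the part of [u]; for odd [u] it is below [n] because [n] is odd. *)
have plt : ((if odd u then u.+1 else u.-1) < n)%N by have := ltn_ord u; case: ifP; lia.
have -> : [set w | (w != Ordinal n0) && K122 u w] = ~: [set Ordinal n0; u; Ordinal plt].
  apply/setP => w; rewrite !inE -!val_eqE /K122 /=.
  by case: ifP; lia.
rewrite cardsCs setCK card_ord setUC cardsU1 cards2 !inE -!val_eqE /=.
by case: ifP; lia.
Qed.

Theorem theorem1 (R : realType) (n : nat) (e : rel 'I_n) (lam : R) :
  simple_graph e -> connected e -> ~ transmission_regular e ->
  largest_eigenvalue (distQ_mx R e) lam ->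
  let tau := 2 * (Dmax e)%:R - lam in
  (odd n ->
     let b := (n%:R + 2 - Num.sqrt (n%:R ^+ 2 + 4 * n%:R - 4)) / 2 in
     b <= tau /\ (tau = b <-> graph_iso e (@K122 n))) /\
  (~~ odd n ->
     let b := (n%:R + 4 - Num.sqrt (n%:R ^+ 2 + 8 * n%:R)) / 2 in
     b <= tau /\ (tau = b <-> exists e' : rel 'I_n, DVDR (n - 4) e' /\ graph_iso e e')).
Proof.
move=> se ce nreg [/eigenvalueP[v vQ v0] lam_max] tau.
have n1 : (1 < n)%N.
  rewrite ltnNge; apply/negP => n1; apply: nreg => i j; congr trans; apply/val_inj => /=.
  by have := ltn_ord i; have := ltn_ord j; lia.
have [u tu] : exists u, (trans e u < Dmax e)%N.
  apply/existsP; rewrite -[X in is_true X]negbK negb_exists; apply/negP => /forallP full.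
  apply: nreg => i j.
  have E x : trans e x = Dmax e.
    by apply/eqP; rewrite eqn_leq trans_le_Dmax leqNgt full.
  by rewrite !E.
split=> parity b.
  (* The case c = 1: (n + 2)^2 - 8 = n^2 + 4 n - 4. *)
  have bE : b = (n%:R + 2 * 1%:R - Num.sqrt ((n%:R + 2 * 1%:R) ^+ 2 - 8 * 1%:R)) / 2.
    by rewrite /b; congr ((_ - Num.sqrt _) / 2); ring.
  have tu1 : (trans e u + 1 <= Dmax e)%N by rewrite addn1.
  have := deficient_vertex_extremal R _ _ se u 1 lam v n1 isT tu1 vQ v0.
  rewrite /= -bE => -[bound ext]; split=> //; split.
    move=> /ext[r rn cr]; apply: (cone_regular_K122 _ _ u r) => //; lia.
  move=> [f fE]; have [v' cr n3] := K122_cone_regular n parity n1.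
  rewrite -(permKV f v') in cr.
  have {}cr := cone_regular_iso _ _ _ f _ _ fE cr.
  have [_ _ lE] : [/\ 0 < b, b < 1 & b ^+ 2 + 2 * 1%:R = (n%:R + 2 * 1%:R) * b].
    by rewrite bE; apply: small_root; rewrite ?ltr1n ?ltr0n.
  have rn : (n - 3 + 1 + 2 = n)%N by lia.
  (* 2 Dmax - b is an eigenvalue, so it is at most [lam], which means tau <= b. *)
  have := lam_max _ (cone_regular_eigenvalue _ _ _ se _ _ _ _ cr rn lE).
  by move=> le; apply/eqP; rewrite eq_le bound andbT /tau; lra.
(* The case c = 2: (n + 4)^2 - 16 = n^2 + 8 n. *)
have bE : b = (n%:R + 2 * 2%:R - Num.sqrt ((n%:R + 2 * 2%:R) ^+ 2 - 8 * 2%:R)) / 2.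
  by rewrite /b; congr ((_ - Num.sqrt _) / 2); ring.
have [l0 l1 lE] : [/\ 0 < b, b < 1 & b ^+ 2 + 2 * 2%:R = (n%:R + 2 * 2%:R) * b].
  by rewrite bE; apply: small_root; rewrite ?ltr1n ?ltr0n.
have [bound ext] : b <= tau /\ (tau = b -> exists w, exists2 r, (r + 2 + 2 = n)%N & cone_regular w r e).
  have [/existsP[w tw]|/existsPn no2] := boolP [exists w, trans e w + 2 <= Dmax e]%N.
    have := deficient_vertex_extremal R _ _ se w 2 lam v n1 isT tw vQ v0.
    by rewrite /= -bE => -[? ext]; split=> // /ext; exists w.
  (* All deficiencies are now at most 1. A second deficient vertex makes the bound strict, so
     equality holds vacuously. *)
  have [/existsP[w /andP[wu tw]]|/existsPn no1] := boolP [exists w, (w != u) && (trans e w < Dmax e)]%N.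
    have def1 x : (trans e x < Dmax e)%N -> 1 <= (Dmax e)%:R - (trans e x)%:R :> R.
      by move=> tx; rewrite lerBrDl natr1 ler_nat.
    have lt : b < tau.
      apply: (two_deficient_vertices_bound _ _ _ se v lam u w) => //; rewrite 1?eq_sym ?def1 //.
    by split=> [|tE]; [exact: ltW|move: lt; rewrite tE ltxx].
  (* Only [u] is deficient, by exactly 1, so the transmissions sum to n Dmax - 1, which is odd for
     even [n]. *)
  have := odd_sum_trans _ _ se.
  have : (\sum_(i < n) trans e i + 1 = n * Dmax e)%N.
    have -> : (1 = \sum_(i < n) (i == u))%N by rewrite -big_mkcond big_pred1_eq.
    have -> : (n * Dmax e = \sum_(i < n) Dmax e)%N by rewrite sum_nat_const card_ord.
    rewrite -big_split /=; apply: eq_bigr => i _.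
    have := trans_le_Dmax _ e i; have := no1 i; have := no2 u.
    by have [->|] := eqVneq i u; rewrite /=; lia.
  move=> /(congr1 odd); rewrite oddD oddM (negPf parity) /=; by case: odd.
split=> //; split.
  move=> /ext[w [r rn cr]]; exists e; split; last by exists 1%g => x y; rewrite !perm1.
  by split=> //; split=> //; exists w; have -> : (n - 4 = r)%N by lia.
move=> [e' [[_ [_ [w cr]]] [f fE]]].
have {}cr : cone_regular (f (f^-1%g w)) (n - 4) e' by rewrite permKV.
have {}cr := cone_regular_iso _ _ _ f _ _ fE cr.
(* Since [n - 4] is truncated, n < 4 must be excluded: then n = 2 and both transmissions are 1,
   against non-regularity. *)
have rn : (n - 4 + 2 + 2 = n)%N.
  have [//|n4] := leqP 4 n; first by lia.
  have t1 x : trans e x = 1%N.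
    have [->|/(cone_regular_trans _ _ se _ _ _ cr)] := eqVneq x ((f^-1)%g w); last by lia.
    by have := trans_dominating _ e _ cr.1; lia.
  by case: nreg => i j; rewrite !t1.
have := lam_max _ (cone_regular_eigenvalue _ _ _ se _ _ _ _ cr rn lE).
by move=> le; apply/eqP; rewrite eq_le bound andbT /tau; lra.
Qed.
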